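(* Let $k,\ell$ be integers with $3 \leq \ell < k$. Then every finite graph that contains no cycle of length exactly $\ell$ and has average degree at least $96 \cdot d_k(\ell)$ contains cycles of $k$ consecutive even lengths, i.e. cycles of lengths $2m+2, 2m+4, \dots, 2m+2k$ for some integer $m \geq 0$. In particular, whenever $c_k(\ell)$ is defined (i.e. $k\mathbb{Z}+\ell$ contains even integers), \[ d_k(\ell) \leq c_k(\ell) \leq 96 \cdot d_k(\ell). \]
   Context: All graphs are finite and simple. $C_\ell$ denotes the cycle of length $\ell$. For positive integers $k,\ell$, $d_k(\ell)$ denotes the largest possible average degree of a bipartite graph on $k$ vertices containing no cycle $C_\ell$ (as a subgraph). For positive integers $k,\ell$ such that the set $k\mathbb{Z}+\ell$ contains even integers, $c_k(\ell)$ denotes the least real number such that every graph of average degree at least $c_k(\ell)$ contains a cycle whose length is congruent to $\ell$ modulo $k$. *)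

(* Defs.v *)
From HB Require Import structures.
From mathcomp Require Import all_boot all_order all_algebra.
From mathcomp Require Import classical_sets reals.

Set Implicit Arguments.
Unset Strict Implicit.
Unset Printing Implicit Defensive.

Import Order.TTheory GRing.Theory Num.Theory.
Local Open Scope ring_scope.

(* A graph is given by its adjacency relation on a finite type of vertices. *)
Definition simple_graph (T : finType) (e : rel T) : bool :=
  [forall x, ~~ e x x] && [forall x, forall y, e x y == e y x].

Definition bipartite (T : finType) (e : rel T) : bool :=
  [exists A : {set T}, forall x, forall y, e x y ==> ((x \in A) != (y \in A))].

(* The bound 3 <= n is needed: ucycleb e [:: x; y] holds for every edge xy of a
   simple graph, and ucycleb e [::] holds always. *)
Definition has_cycle (T : finType) (e : rel T) (n : nat) : bool :=
  (3 <= n)%N && [exists c : n.-tuple T, ucycleb e c].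

(* Equal to 0 for the graph without vertices. *)
Definition avg_degree (R : realType) (T : finType) (e : rel T) : R :=
  (\sum_(x : T) #|[pred y | e x y]|)%N%:R / #|T|%:R.

(* The neutral value 0 of the maximum d_k(l) is the average degree of the
   edgeless graph on k vertices, which is among the candidates. *)
Definition dk (R : realType) (k l : nat) : R :=
  \big[Num.max/0]_(E : {set 'I_k * 'I_k} |
      let e := [rel x y | (x, y) \in E] in
      [&& simple_graph e, bipartite e & ~~ has_cycle e l])
    avg_degree R [rel x y | (x, y) \in E].

Definition forces_cycle_mod (R : realType) (k l : nat) : set R :=
  [set c : R | forall (T : finType) (e : rel T),
     simple_graph e -> c <= avg_degree R e ->
     exists2 n : nat, has_cycle e n & n = l %[mod k]].

(* c = c_k(l); no such c exists when no even integer is congruent to l modulo k. *)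
Definition is_ck (R : realType) (k l : nat) (c : R) : Prop :=
  forces_cycle_mod k l c /\ lbound (forces_cycle_mod k l) c.

(* Main.v *)
(* A graph of large average degree has a bipartite subgraph with half of its
   edges, and in a breadth-first layering of that subgraph the edges between some
   two consecutive layers [L_i], [L_(i+1)] contain a subgraph [H] of minimum degree
   [d > 8 d_k(l)].  In a bipartite [C_l]-free graph every set [Y] of at most [2k]
   vertices spans fewer than [d|Y|/6] edges, so Posa rotations in [H] give a cycle
   with more than [2k] vertices and a chord.  Colour a vertex of this cycle in
   [L_i] according to whether its ancestor just below the deepest common ancestor
   of all those vertices is a fixed one.  A cycle with a chord contains paths of
   all lengths [t < n] between the two colour classes, unless the classes are its
   bipartition; for even [t] both ends of the path lie in [L_i], and the path closes
   up through the search tree into a cycle of length [2h + t].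

   For the infimum defining [c_k(l)] to be attained, note that joining two copies
   of a graph by an edge raises the average degree without creating cycles. *)
Require Import Defs.
From HB Require Import structures.
From mathcomp Require Import all_boot all_order all_algebra.
From mathcomp Require Import boolp classical_sets reals.
From mathcomp Require Import zify ring lra.

Set Implicit Arguments.
Unset Strict Implicit.
Unset Printing Implicit Defensive.

Import Order.TTheory GRing.Theory Num.Theory.
Local Open Scope ring_scope.

(** * Counting edges *)

(** Ordered pairs are counted: for a symmetric relation this is twice the number of edges inside
    [V], that is, the degree sum. *)
Definition nedges (T : finType) (e : rel T) (V : {set T}) : nat :=
  (\sum_(x in V) \sum_(y in V) e x y)%N.

Section Counting.
Local Open Scope nat_scope.
Variables (T : finType) (e : rel T).
Hypotheses (esym : symmetric e) (eirr : irreflexive e).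
Implicit Types (V W : {set T}).

Lemma nedges_del V x : x \in V ->
  nedges e V = nedges e (V :\ x) + 2 * \sum_(y in V) e x y.
Proof.
move=> xV.
have split1 z : \sum_(y in V) e z y = e z x + \sum_(y in V :\ x) e z y.
  by rewrite (big_setD1 x).
rewrite /nedges (big_setD1 x) //= (eq_bigr _ (fun z _ => split1 z)) big_split /=.
have -> : \sum_(z in V :\ x) e z x = \sum_(z in V :\ x) e x z.
  by apply: eq_bigr => z _; rewrite esym.
by rewrite split1 eirr; lia.
Qed.

(** Deleting a vertex of degree below [d] lowers [nedges] by less than [2 * d], so the hypothesis
    persists. It fails for the empty set, hence the deletion stops earlier. *)
Lemma min_degree_subset (d : nat) V : 2 * d * #|V| < nedges e V ->
  exists2 W : {set T}, W \subset V & W != finset.set0 /\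
    (forall x, x \in W -> d <= \sum_(y in W) e x y).
Proof.
move: {2}#|V| (leqnn #|V|) => n; elim: n V => [|n IH] V.
  rewrite leqn0 cards_eq0 => /eqP->.
  by rewrite /nedges big_set0.
move=> leVn ltE.
have [/existsP[x /andP[xV ltx]]|] :=
    boolP [exists x, (x \in V) && (\sum_(y in V) e x y < d)].
  have cV := cardsD1 x V; rewrite xV /= in cV.
  have leVn' : #|V :\ x| <= n by lia.
  have [|W WV HW] := IH (V :\ x) leVn'.
    by move: ltE; rewrite (nedges_del xV) cV; nia.
  by exists W; [apply: fintype.subset_trans WV (subD1set _ _) | ].
rewrite negb_exists => /forallP HV; exists V => //; split.
  by apply: contraTneq ltE => ->; rewrite /nedges big_set0.
by move=> x xV; move: (HV x); rewrite xV -leqNgt.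
Qed.

(** Deleting a vertex of at most average degree never lowers the density, the quotient of
    [nedges e V] by [#|V| * #|V|.-1]. This is repeated down to [k] vertices. *)
Lemma dense_subset (k : nat) V : 2 <= k <= #|V| ->
  exists2 W : {set T}, W \subset V & #|W| = k /\
    nedges e V * (k * k.-1) <= nedges e W * (#|V| * #|V|.-1).
Proof.
move: {2}#|V| (leqnn #|V|) => n; elim: n V => [|n IH] V; first by lia.
move=> leVn /andP[k2 kV].
have [cVk|neq] := eqVneq #|V| k; first by exists V => //; rewrite cVk.
have [x xV lex] : exists2 x, x \in V & #|V| * (\sum_(y in V) e x y) <= nedges e V.
  apply/exists_inP; apply: contraT; rewrite negb_exists_in => /forall_inP HV.
  have V0 : 0 < #|V| by lia.
  have : \sum_(x in V) nedges e V < \sum_(x in V) #|V| * \sum_(y in V) e x y.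
    have [z zV] := card_gt0P V0.
    rewrite (bigD1 z) //= [ltnRHS](bigD1 z) //= -addSn leq_add //.
      by rewrite ltnNge HV.
    by apply: leq_sum => x /andP[xV _]; apply: ltnW; rewrite ltnNge HV.
  by rewrite sum_nat_const -big_distrr /= ltnn.

have cV := cardsD1 x V; rewrite xV /= add1n in cV.
have Ed := nedges_del xV.
have leVn' : #|V :\ x| <= n by lia.
have [|W WV [cW HW]] := IH (V :\ x) leVn'; first by lia.
exists W; first exact: fintype.subset_trans WV (subD1set _ _).
split=> //; move: lex Ed HW; rewrite cV /=.
move: (nedges e V) (nedges e (V :\ x)) (nedges e W) (\sum_(y in V) e x y) => E E' F g.
have : 1 < #|V :\ x| by lia.
case: #|V :\ x| => [|[|q]] // _; rewrite /= => lex Ed HW.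
(* Here [#|V| = q.+3]; the claim follows from [E = E' + 2 * g] and [#|V| * g <= E]. *)
have h1 : E * q.+1 <= E' * q.+3 by nia.
have h2 := leq_mul h1 (leqnn (k * k.-1)).
have h3 := leq_mul HW (leqnn q.+3).
rewrite -(leq_pmul2r (ltn0Sn q)); nia.
Qed.

End Counting.

(** * Large cuts *)

Section Cut.
Local Open Scope nat_scope.
Variables (T : finType) (e : rel T).

(** Averaging over all vertex sets: each edge is cut by exactly half of them. *)
Lemma half_cut (eirr : irreflexive e) : exists A : {set T},
  nedges e [set: T] <= 2 * nedges [rel x y | e x y && ((x \in A) != (y \in A))] [set: T].
Proof.
have card_sep x y : x != y ->
    2 * \sum_(A : {set T}) ((x \in A) != (y \in A)) = #|{set T}|.
  move=> xy.
  (* Toggling the membership of [x] matches the sets separating [x] and [y] with those that do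
     not. *)
  pose tog (A : {set T}) := [set z | (z \in A) (+) (z == x)].
  have togK : involutive tog.
    by move=> A; apply/setP => z; rewrite !inE -addbA addbb addbF.
  have -> : 2 * \sum_(A : {set T}) ((x \in A) != (y \in A)) =
    \sum_(A : {set T}) ((x \in A) != (y \in A)) +
    \sum_(A : {set T}) ((x \in tog A) != (y \in tog A)).
    rewrite mul2n -addnn; congr addn.
    rewrite (reindex_inj (inv_inj togK)) /=.
    by apply: eq_bigr.
  rewrite -big_split /= -[RHS]sum1_card; apply: eq_bigr => A _.
  by rewrite !inE eqxx [y == x]eq_sym (negbTE xy) addbT addbF; do 2 case: (_ \in A).
apply/existsP; apply: contraT; rewrite negb_exists => /forallP HA.
pose F (A : {set T}) := nedges [rel x y | e x y && ((x \in A) != (y \in A))] [set: T].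
have sumF : 2 * \sum_(A : {set T}) F A = #|{set T}| * nedges e [set: T].
  rewrite /F /nedges exchange_big /= big_distrr big_distrr /=.
  apply: eq_bigr => x _; rewrite exchange_big /= big_distrr big_distrr /=.
  apply: eq_bigr => y _.
  have [exy|_] := boolP (e x y); last by rewrite big1 ?muln0.
  rewrite muln1 -(card_sep x y) //.
  by apply: contraTneq exy => ->; rewrite eirr.
have : \sum_(A : {set T}) 2 * F A < \sum_(A : {set T}) nedges e [set: T].
  rewrite (bigD1 finset.set0) //= [ltnRHS](bigD1 finset.set0) //= -addSn leq_add //.
    by rewrite ltnNge HA.
  by apply: leq_sum => A _; apply: ltnW; rewrite ltnNge HA.
by rewrite -big_distrr /= sumF sum_nat_const ltnn.
Qed.

End Cut.

(** * Sparsity of bipartite graphs without [C_l] *)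

Lemma simple_graphP (T : finType) (e : rel T) :
  reflect (irreflexive e /\ symmetric e) (simple_graph e).
Proof.
apply: (iffP andP) => [[/forallP e1 /forallP e2]|[e1 e2]].
  by split=> [x|x y]; [apply: negbTE | apply/eqP; move/forallP: (e2 x)].
by split; apply/forallP => x; [rewrite e1 | apply/forallP => y; rewrite e2].
Qed.

Lemma bipartiteP (T : finType) (e : rel T) :
  reflect (exists A : {set T}, forall x y, e x y -> (x \in A) != (y \in A))
    (bipartite e).
Proof.
apply: (iffP existsP) => -[A HA]; exists A.
  by move=> x y; move/forallP/(_ x)/forallP/(_ y)/implyP: HA.
by apply/forallP => x; apply/forallP => y; apply/implyP; apply: HA.
Qed.

Lemma has_cycleP (T : finType) (e : rel T) n :
  reflect (exists s : seq T, [/\ size s = n, (3 <= n)%N, uniq s & cycle e s])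
    (has_cycle e n).
Proof.
apply: (iffP andP) => [[n3 /existsP[c /andP[cc uc]]]|[s [sn n3 us cs]]].
  by exists c; split=> //; rewrite size_tuple.
split=> //; apply/existsP; have /eqP sn' := sn.
by exists (Tuple sn'); rewrite /ucycleb /= cs us.
Qed.

Lemma has_cycle_size (T : finType) (e : rel T) n :
  has_cycle e n -> (3 <= n <= #|T|)%N.
Proof.
by move=> /has_cycleP[s [<- -> us _]]; rewrite -(card_uniqP us) max_card.
Qed.

Lemma path_const (T X : eqType) (e : rel T) (b : T -> X) x p :
  (forall y z, e y z -> b y = b z) -> path e x p ->
  forall y, y \in p -> b y = b x.
Proof.
move=> Hb; elim: p x => //= z p IH x /andP[exz pp] y.
by rewrite inE => /orP[/eqP->|/(IH _ pp)->]; rewrite (Hb _ _ exz).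
Qed.

(** A label [b] that is constant along edges is constant on a cycle. So [phi] need only be injective
    on vertices of equal label that have a neighbour, which covers embeddings as well as projections
    of disjoint copies. *)
Lemma has_cycle_hom (T1 T2 : finType) (X : eqType) (e1 : rel T1) (e2 : rel T2)
    (phi : T1 -> T2) (b : T1 -> X) n :
  {homo phi : x y / e1 x y >-> e2 x y} ->
  (forall x y, e1 x y -> b x = b y) ->
  (forall x x' y y', e1 x y -> e1 x' y' -> b x = b x' -> phi x = phi x' ->
     x = x') ->
  has_cycle e1 n -> has_cycle e2 n.
Proof.
move=> Hphi Hb Hi /has_cycleP[s [sn n3 us cs]].
apply/has_cycleP; exists (map phi s); split=> //.
- by rewrite size_map.
- rewrite map_inj_in_uniq // => x y xs ys; apply: (Hi) (next_cycle cs xs) (next_cycle cs ys) _.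
  case: s cs xs ys {sn us} => // z s cs.
  have Hz w : w \in z :: s -> b w = b z.
    by move=> ws; apply: (path_const Hb cs); rewrite mem_rcons.
  by move=> /Hz-> /Hz->.
- exact: homo_cycle cs.
Qed.

Lemma nedgesT (T : finType) (e : rel T) :
  nedges e [set: T] = (\sum_x \sum_y e x y)%N.
Proof.
rewrite /nedges (eq_bigl predT) => [|x]; last by rewrite inE.
by apply: eq_bigr => x _; apply: eq_bigl => y; rewrite inE.
Qed.

Lemma nedgesE (T : finType) (e : rel T) :
  nedges e [set: T] = #|[set p : T * T | e p.1 p.2]|.
Proof.
rewrite nedgesT pair_bigA -sum1dep_card [RHS]big_mkcond.
by apply: eq_bigr => p _; case: (e _ _).
Qed.

Lemma nedges_sub (T : finType) (e1 e2 : rel T) (V : {set T}) :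
  (forall x y, e1 x y -> e2 x y) -> (nedges e1 V <= nedges e2 V)%N.
Proof.
move=> H; apply: leq_sum => x _; apply: leq_sum => y _.
by have := H x y; case: (e1 x y) => // ->.
Qed.

Lemma avg_degreeE (R : realType) (T : finType) (e : rel T) :
  avg_degree R e = (nedges e [set: T])%:R / #|T|%:R.
Proof.
rewrite /avg_degree nedgesT; congr (_%:R / _); apply: eq_bigr => x _.
by rewrite -sum1_card big_mkcond; apply: eq_bigr => y _; rewrite inE; case: (e x y).
Qed.

Lemma dk_ge0 (R : realType) k l : 0 <= dk R k l.
Proof. exact: bigmax_ge_id. Qed.

Section Dk.
Variables (R : realType) (k l : nat).
Hypothesis l3 : (3 <= l)%N.

(** The graph is copied into ['I_k], the other vertices staying isolated, and so becomes a candidate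
    in the maximum [dk]. *)
Lemma dk_ge (T : finType) (e : rel T) :
  simple_graph e -> bipartite e -> ~~ has_cycle e l -> (#|T| <= k)%N ->
  (nedges e [set: T])%:R <= dk R k l * k%:R.
Proof.
move=> /simple_graphP[ei es] /bipartiteP[A HA] nc Tk.
have [T0|/card_gt0P[x0 _]] := posnP #|T|.
  by rewrite nedgesT big_pred0 ?mulr_ge0 ?dk_ge0 // => x; have := fintype0 x T0.
have k0 : (0 < k)%N by apply: leq_trans Tk; apply/card_gt0P; exists x0.
have [phi phi_inj] : exists phi : T -> 'I_k, injective phi.
  exists (fun x => widen_ord Tk (enum_rank x)) => x y [].
  by move/val_inj/enum_rank_inj.
(* A left inverse of [phi], along which cycles are pulled back. The default [x0] is taken only off
   the image of [phi], where vertices are isolated. *)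
pose psi i := odflt x0 [pick x | phi x == i].
have phiK : cancel phi psi.
  move=> x; rewrite /psi; case: pickP => [y /eqP/phi_inj //|/(_ x)].
  by rewrite eqxx.
pose E := [set (phi p.1, phi p.2) | p in [set p : T * T | e p.1 p.2]].
have EP i j : (i, j) \in E -> exists x y, [/\ i = phi x, j = phi y & e x y].
  by case/imsetP => -[x y]; rewrite inE /= => exy [-> ->]; exists x, y.
pose e' := [rel i j | (i, j) \in E].
have cE : nedges e' [set: 'I_k] = nedges e [set: T].
  rewrite !nedgesE.
  have -> : [set p : 'I_k * 'I_k | e' p.1 p.2] = E.
    by apply/setP => -[i j]; rewrite inE.
  by rewrite card_imset // => -[x y] [x' y'] /= [/phi_inj-> /phi_inj->].
have He' : [&& simple_graph e', bipartite e' & ~~ has_cycle e' l].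
  apply/and3P; split.
  - apply/simple_graphP; split=> [i|i j].
      apply/negbTE/negP => /= /EP[x [y [-> /phi_inj <-]]].
      by rewrite ei.
    suff H i' j' : e' i' j' -> e' j' i' by apply/idP/idP; apply: H.
    move=> /EP[x [y [-> -> exy]]]; apply/imsetP; exists (y, x) => //.
    by rewrite inE /= es.
  - apply/bipartiteP; exists (phi @: A) => i j /EP[x [y [-> -> exy]]].
    by rewrite !mem_imset // HA.
  - apply: contra nc.
    apply: (@has_cycle_hom _ _ unit e' e psi (fun=> tt)) => //.
      by move=> i j /EP[x [y [-> -> exy]]]; rewrite !phiK.
    by move=> ? ? ? ? /EP[x [_ [-> _ _]]] /EP[x' [_ [-> _ _]]] _; rewrite !phiK => ->.
rewrite -cE -ler_pdivrMr ?ltr0n //.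
have := @avg_degreeE R _ e'; rewrite card_ord => <-.
exact: (@le_bigmax_cond _ _ _ _ E
  (fun E : {set 'I_k * 'I_k} => let e := [rel x y | (x, y) \in E] in
      [&& simple_graph e, bipartite e & ~~ has_cycle e l])
  (fun E : {set 'I_k * 'I_k} => avg_degree R [rel x y | (x, y) \in E])).
Qed.

(* Disjoint copies of the subgraph induced by [Y] fill up at least half of [k]
   vertices. *)
Lemma dk_copies (T : finType) (e : rel T) (Y : {set T}) :
  simple_graph e -> bipartite e -> ~~ has_cycle e l -> (0 < #|Y| <= k)%N ->
  ((k %/ #|Y|) * nedges e Y)%:R <= dk R k l * k%:R.
Proof.
move=> /simple_graphP[ei es] /bipartiteP[A HA] nc /andP[Y0 Yk].
set q := (k %/ #|Y|)%N.
pose U : finType := ('I_q * {x | x \in Y})%type.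
pose e' : rel U := [rel u v | (u.1 == v.1) && e (val u.2) (val v.2)].
have cU : (#|{: U}| <= k)%N.
  by rewrite card_prod card_ord card_sig leq_divM.
have -> : (q * nedges e Y = nedges e' [set: U])%N.
  rewrite nedgesT -(pair_bigA _ (fun a b => \sum_(y : U) e' (a, b) y))%N /=.
  rewrite -[q in LHS]card_ord -sum_nat_const; apply: eq_bigr => a _.
  rewrite /nedges big_sub; apply: eq_bigr => x _.
  rewrite -(pair_bigA _ (fun c d => nat_of_bool (e' (a, x) (c, d)))) /=.
  rewrite (bigD1 a) //= [X in (_ + X)%N]big1 ?addn0.
    by rewrite [LHS]big_sub; apply: eq_bigr => y _; rewrite /e' /= eqxx.
  by move=> b /negbTE ba; rewrite big1 // => y _; rewrite /e' /= eq_sym ba.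
apply: dk_ge => //.
- apply/simple_graphP; split=> [u|u v]; rewrite /e' /=; first by rewrite ei andbF.
  by rewrite eq_sym es.
- apply/bipartiteP; exists [set u : U | val u.2 \in A] => u v /andP[_ /HA].
  by rewrite !inE.
- apply: contra nc.
  apply: (@has_cycle_hom _ _ _ e' e (fun u => val u.2) (fun u => u.1)) => //=.
  + by move=> u v /andP[].
  + by move=> u v /andP[/eqP].
  + by move=> [a x] [b y] _ _ _ _ /= -> /val_inj->.
Qed.

(** For at most [k] vertices, disjoint copies even give the factor 2 instead of 7/3. For larger [Y],
    a [k]-subset at least as dense as [Y] gives the factor [(#|Y| - 1) / (k - 1)]. *)
Lemma dk_sparse (T : finType) (e : rel T) (Y : {set T}) :
  (4 <= k)%N ->
  simple_graph e -> bipartite e -> ~~ has_cycle e l -> (0 < #|Y| <= 2 * k)%N ->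
  (3 * nedges e Y)%:R <= 7%:R * dk R k l * #|Y|%:R.
Proof.
move=> k4 se be nc /andP[Y0 Y2k]; have D0 := dk_ge0 R k l.
set D := dk R k l in D0 *.
have [Yk|kY] := leqP #|Y| k.
  have := dk_copies se be nc (introT andP (conj Y0 Yk)).
  rewrite -/D natrM; set q := (k %/ #|Y|)%N => qE.
  have q1 : (1 <= q)%N by rewrite /q divn_gt0.
  have kq : (k <= 2 * q * #|Y|)%N.
    have := divn_eq k #|Y|; have := ltn_pmod k Y0; rewrite -/q.
    by nia.
  have : q%:R * (nedges e Y)%:R <= q%:R * (2%:R * D * #|Y|%:R) :> R.
    apply: (le_trans qE).
    have -> : q%:R * (2%:R * D * #|Y|%:R) = D * (2 * q * #|Y|)%:R :> R.
      by rewrite !natrM; ring.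
    by rewrite ler_wpM2l // ler_nat.
  rewrite ler_pM2l ?ltr0n // natrM => H.
  have : 0 <= D * #|Y|%:R by rewrite mulr_ge0.
  lra.
have [ei es] := simple_graphP _ se.
have [|W _ [cW HW]] := dense_subset es ei (V := Y) (k := k).
  by lia.
have k0 : (0 < k)%N by lia.
have := dk_copies se be nc (Y := W); rewrite cW leqnn divnn k0 /=.
rewrite mul1n -/D => /(_ isT) HE.
have : (nedges e Y * (k * k.-1))%:R <= (nedges e W * (#|Y| * #|Y|.-1))%:R :> R.
  by rewrite ler_nat.
case: k k4 kY Y2k HE {HW cW} => // k' k4; case: #|Y| Y0 => // y _ /= kY Y2k HE.
rewrite !natrM => HH.
have k'0 : 0 < k'%:R :> R by rewrite ltr0n; lia.
have H1 : (nedges e Y)%:R * k'%:R <= D * y.+1%:R * y%:R :> R.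
  rewrite -(ler_pM2l (_ : 0 < k'.+1%:R)) ?ltr0n //.
  apply: le_trans (_ : (nedges e W)%:R * (y.+1%:R * y%:R) <= _).
    by apply: le_trans HH; rewrite le_eqVlt; apply/orP; left; apply/eqP; ring.
  apply: le_trans (_ : D * k'.+1%:R * (y.+1%:R * y%:R) <= _).
    by rewrite ler_wpM2r // mulr_ge0.
  by rewrite le_eqVlt; apply/orP; left; apply/eqP; ring.
rewrite -(ler_pM2r k'0).
(* With [#|Y| = y.+1] and [k = k'.+1], the worst ratio [(2 * k - 1) / (k - 1)] is at most 7/3
   because [4 <= k]. *)
have H2 : 3%:R * y%:R <= 7%:R * k'%:R :> R by rewrite -!natrM ler_nat; lia.
have Dy : 0 <= D * y.+1%:R by rewrite mulr_ge0.
have := ler_wpM2l Dy H2.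
by lra.
Qed.

(** The case of a single edge. A positive absolute bound is what later absorbs the rounding of
    [8 * dk] to an integer. *)
Lemma dk_lower : (4 <= k)%N -> 3%:R <= 7%:R * dk R k l.
Proof.
move=> k4; pose e : rel bool := [rel x y | x != y].
have := @dk_sparse _ e [set: bool] k4; rewrite cardsT card_bool.
have -> : nedges e [set: bool] = 2%N by rewrite nedgesT !big_bool.
move=> H; suff : (3 * 2)%:R <= 7%:R * dk R k l * 2%:R by rewrite natrM; lra.
apply: H.
- by apply/simple_graphP; split => [[]|[] []].
- by apply/bipartiteP; exists [set true] => -[] []; rewrite !inE.
- by apply/negP => /has_cycle_size; rewrite card_bool; lia.
- by lia.
Qed.

End Dk.

(** * Layers *)

Section Levels.
Local Open Scope nat_scope.
Variables (T : finType) (e : rel T).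
Hypothesis (esym : symmetric e).

(** Breadth-first search from one root per component: [lev] is the distance to the root and [par]
    the next vertex on a shortest path to it. The graph may be disconnected, and the last clause
    expresses that a component has a single root. *)
Lemma exists_levels : exists (lev : T -> nat) (par : T -> T),
  [/\ forall x y, e x y -> lev y <= (lev x).+1,
      forall x, 0 < lev x -> e x (par x) /\ lev x = (lev (par x)).+1 &
      forall x y, connect e x y -> lev x = 0 -> lev y = 0 -> x = y].
Proof.
have cs : connect_sym e := sym_connect_sym esym.
pose P n v := [exists p : n.-tuple T,
  path e (fingraph.root e v) p && (last (fingraph.root e v) p == v)].
have PP n v : reflect (exists p, [/\ size p = n, path e (fingraph.root e v) p &
    last (fingraph.root e v) p = v]) (P n v).
  apply: (iffP existsP) => [[p /andP[pp /eqP lp]]|[p [/eqP sp pp lp]]].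
    by exists p; rewrite size_tuple.
  by exists (Tuple sp); rewrite /= pp lp eqxx.
have exP v : exists n, P n v.
  have : connect e (fingraph.root e v) v by rewrite cs connect_root.
  by move=> /connectP[p pp lp]; exists (size p); apply/PP; exists p.
pose lev v := ex_minn (exP v).
have levP v : P (lev v) v by rewrite /lev; case: ex_minnP.
have lev_le n v : P n v -> lev v <= n.
  by move=> Pn; rewrite /lev; case: ex_minnP => m _; apply.
have root_eq x y : e x y -> fingraph.root e x = fingraph.root e y.
  by move=> /connect1/(fingraph.rootP cs).
have lev_step x y : e x y -> lev y <= (lev x).+1.
  move=> exy; apply: lev_le; apply/PP.
  have /PP[p [sp pp lp]] := levP x.
  exists (rcons p y); rewrite size_rcons sp -(root_eq _ _ exy) rcons_path last_rcons.
  by rewrite pp lp exy.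
have parP x : exists y, 0 < lev x -> e x y /\ lev x = (lev y).+1.
  case: (posnP (lev x)) => [->|lx]; first by exists x.
  have /PP[p] := levP x; case/lastP: p => [[sx]|p y [sp]]; first by rewrite -sx in lx.
  rewrite rcons_path last_rcons => /andP[pp ey] yx; subst y.
  exists (last (fingraph.root e x) p) => _; split; first by rewrite esym.
  move: (lev_step _ _ ey); rewrite size_rcons in sp.
  suff : lev (last (fingraph.root e x) p) <= size p by lia.
  apply: lev_le; apply/PP; exists p; split=> //; by rewrite (root_eq _ _ ey).
have [par Hpar] := boolp.choice parP.
exists lev, par; split=> // x y cxy lx ly.
have r0 z : lev z = 0 -> fingraph.root e z = z.
  by move=> lz; have := levP z; rewrite lz => /PP[p [/size0nil-> _ /= ->]].
by rewrite -(r0 x) // -(r0 y) //; apply/(fingraph.rootP cs).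
Qed.

(** The side of a vertex is the side of its root shifted by the parity of its level. Adjacent
    vertices share a root, so their levels cannot be equal. *)
Lemma bipartite_levels (lev : T -> nat) (par : T -> T) : bipartite e ->
  (forall x y, e x y -> lev y <= (lev x).+1) ->
  (forall x, 0 < lev x -> e x (par x) /\ lev x = (lev (par x)).+1) ->
  (forall x y, connect e x y -> lev x = 0 -> lev y = 0 -> x = y) ->
  forall x y, e x y -> lev y = (lev x).+1 \/ lev x = (lev y).+1.
Proof.
move=> /bipartiteP[A HA] h1 h2 h3.
have cs : connect_sym e := sym_connect_sym esym.
have H n x : lev x = n ->
    exists r, [/\ lev r = 0, connect e x r & (x \in A) = (r \in A) (+) odd n].
  elim: n x => [|n IH] x lx; first by exists x; rewrite lx connect0 addbF.
  have [|ex lpx] := h2 x; first by rewrite lx.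
  have [|r [r0 cr Ar]] := IH (par x); first by lia.
  exists r; split=> //; first exact: connect_trans (connect1 ex) cr.
  by have := HA _ _ ex; rewrite Ar /= addbN; case: (x \in A); case: (_ (+) _).
move=> x y exy; have lyx := h1 _ _ exy.
have lxy : lev x <= (lev y).+1 by apply: h1; rewrite esym.
suff : lev x <> lev y by lia.
move=> lE; have [r [r0 cr Ar]] := H _ _ (erefl (lev x)).
have [r' [r0' cr' Ar']] := H _ _ (erefl (lev y)).
have rr : r = r'.
  apply: h3 => //; apply: connect_trans cr'; apply: connect_trans (connect1 exy).
  by rewrite cs.
by have := HA _ _ exy; rewrite Ar Ar' rr lE eqxx.
Qed.

(** Every edge belongs to exactly one layer graph [ei i], and every vertex to at most two sets
    [V i]. If no layer had a subgraph of minimum degree [d], then each would satisfy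
    [nedges (ei i) <= 2 * d * #|V i|], and summing would contradict the density. *)
Lemma dense_layer (eirr : irreflexive e) (lev : T -> nat) (d : nat) :
  (forall x y, e x y -> lev y = (lev x).+1 \/ lev x = (lev y).+1) ->
  4 * d * #|T| < nedges e [set: T] ->
  exists i (W : {set T}), W != finset.set0 /\ forall x, x \in W ->
    d <= \sum_(y in W) (e x y && (minn (lev x) (lev y) == i)).
Proof.
move=> hlev; apply: contraPP => /forallNP noW; apply/negP; rewrite -leqNgt.
pose ei i := [rel x y | e x y && (minn (lev x) (lev y) == i)].
pose V i := [set x | (lev x == i) || (lev x == i.+1)].
pose N := (\max_x lev x).+1.
have levN x : lev x < N by rewrite ltnS leq_bigmax.
have eV i : nedges (ei i) [set: T] <= 2 * d * #|V i|.
  have -> : nedges (ei i) [set: T] = nedges (ei i) (V i).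
    have ei0 x y : ~~ ((x \in V i) && (y \in V i)) -> ei i x y = false.
      rewrite /ei !inE /=; apply: contraNF => /andP[/hlev]; lia.
    rewrite nedgesT /nedges [RHS]big_mkcond; apply: eq_bigr => x _ /=.
    have [xV|xV] := boolP (x \in V i).
      rewrite [RHS]big_mkcond; apply: eq_bigr => y _ /=.
      by case: ifPn => // yV; rewrite -[RHS]/(nat_of_bool false) -(ei0 x y) // xV.
    by rewrite big1 // => y _; rewrite -[RHS]/(nat_of_bool false) -(ei0 x y) // (negbTE xV).
  rewrite leqNgt; apply/negP => /min_degree_subset[].
  - by move=> x y; rewrite /ei /= esym minnC.
  - by move=> x; rewrite /ei /= eirr.
  by move=> W _ HW; apply: (noW i); exists W.
have sum_le1 (c a : nat) : \sum_(i < N) (a == c + i) <= 1.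
  rewrite -big_mkcond /= sum1_card; apply/card_le1_eqP => i j.
  by move=> /eqP ai /eqP aj; apply: val_inj => /=; lia.
have -> : nedges e [set: T] = \sum_(i < N) nedges (ei i) [set: T].
  under [RHS]eq_bigr do rewrite nedgesT.
  rewrite nedgesT [RHS]exchange_big; apply: eq_bigr => x _.
  rewrite [RHS]exchange_big; apply: eq_bigr => y _ /=.
  have mN : minn (lev x) (lev y) < N by rewrite (leq_ltn_trans (geq_minl _ _)).
  rewrite (bigD1 (Ordinal mN)) //= eqxx andbT big1 ?addn0 // => i.
  by rewrite -val_eqE /= eq_sym => /negbTE->; rewrite andbF.
apply: leq_trans (leq_sum _ _) _; first by move=> i _; apply: eV.
rewrite -big_distrr /=.
suff : \sum_(i < N) #|V i| <= 2 * #|T|.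
  by move=> /(leq_mul (leqnn (2 * d))) H; apply: (leq_trans H); rewrite mulnACA mulnA.
have cV (i : 'I_N) : #|V i| <= \sum_x ((lev x == 0 + i) + (lev x == 1 + i)).
  rewrite -sum1_card big_mkcond /=; apply: leq_sum => x _.
  by rewrite inE add0n add1n; do 2 case: (lev x == _).
apply: leq_trans (leq_sum _ _) _; first by move=> i _; apply: cV.
rewrite exchange_big /= mulnC -sum_nat_const; apply: leq_sum => x _.
by rewrite big_split /= -[2]/(1 + 1) leq_add.
Qed.

End Levels.

(** * Posa rotations *)

Section SeqFacts.
Variable T : eqType.
Implicit Types (a b s t : seq T).

Lemma cat_eq_cat a b s t : a ++ b = s ++ t ->
  (exists2 r, s = a ++ r & b = r ++ t) \/ (exists2 r, a = s ++ r & t = r ++ b).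
Proof.
elim: s a => [|x s IH] [|y a] /=; try by [right; exists [::]].
- by move=> <-; right; exists (y :: a).
- by move=> ->; left; exists (x :: s).
- by case=> <- /IH[[r -> ->]|[r -> ->]]; [left|right]; exists r.
Qed.

Lemma uniq_cat_cons_inj y a b s t :
  uniq (a ++ y :: b) -> a ++ y :: b = s ++ y :: t -> a = s.
Proof.
move=> u E; have u' := u; rewrite E in u'.
have idx p q : uniq (p ++ y :: q) -> index y (p ++ y :: q) = size p.
  rewrite cat_uniq /= negb_or => /and3P[_ /andP[yp _] _].
  by rewrite index_cat (negbTE yp) /= eqxx addn0.
have := congr1 (index y) E; rewrite !idx // => sE.
by have := congr1 (take (size a)) E; rewrite take_size_cat // take_size_cat.
Qed.

Lemma next_cat_cons a u v b :
  uniq (a ++ u :: v :: b) -> next (a ++ u :: v :: b) u = v.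
Proof.
by move=> un; rewrite -(next_rot (size a)) // rot_size_cat /= eqxx.
Qed.

Lemma next_rcons x a y : uniq (x :: rcons a y) -> next (x :: rcons a y) y = x.
Proof.
move=> un; rewrite -(next_rot (size (x :: a))) // -rcons_cons -cats1.
by rewrite rot_size_cat /= eqxx.
Qed.

End SeqFacts.

Section Posa.
Local Open Scope nat_scope.
Variables (T : finType) (f : rel T).
Hypothesis fsym : symmetric f.

(** In a rotation the edge [x y] replaces the edge entering [y], whose other end becomes the new
    first vertex. The last vertex of the path stays fixed. *)
Inductive rotation (C : seq T) : seq T -> Prop :=
| Rotation0 : rotation C C
| RotationS x a y b : rotation C (x :: a ++ y :: b) -> f x y ->
    rotation C (rev (x :: a) ++ y :: b).

Lemma rotation_perm C q : rotation C q -> perm_eq q C.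
Proof.
elim=> [//|x a y b _ IH _]; apply: perm_trans IH.
by rewrite -cat_cons perm_cat2r perm_rev.
Qed.

(** The reversed segment is a path by symmetry of [f]. The tail [R] is never touched, so rotations
    of an initial segment act on a longer path. *)
Lemma rotation_sorted C R q : rotation C q -> sorted f (C ++ R) -> sorted f (q ++ R).
Proof.
move=> + sC; elim=> [//|x a y b _ IH fxy].
move: IH; rewrite /= -!catA /= cat_path /= => /and3P[pa _ pb].
rewrite rev_cons cat_rcons -cat_rcons -rev_cons.
case: (lastP a) pa => [|a' z] pa.
  by rewrite /= fxy.
rewrite rev_cons rev_rcons /= cat_path rcons_path last_rcons /= fxy pb !andbT.
have := rev_path f x (rcons a' z); rewrite last_rcons belast_rcons.
rewrite (@eq_path _ (fun u v => f v u) f) ?pa => [|u v]; last exact: fsym.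
by rewrite rev_cons rcons_path.
Qed.

Definition rotation_heads (C : seq T) : {set T} :=
  [set x | `[< exists q, rotation C (x :: q) >]].

Lemma rotation_headsS C x a y b : rotation C (x :: a ++ y :: b) -> f x y ->
  last x a \in rotation_heads C.
Proof.
move=> rC fxy; rewrite inE; apply/asboolP.
have := RotationS rC fxy; case: (lastP a) => [|a' z] /=; first by exists (y :: b).
rewrite rev_cons rev_rcons last_rcons /=.
by exists (rcons (rev a') x ++ y :: b).
Qed.

(* Every rotation removes an edge of the path having an endpoint among the
   heads; so both edges at [y] survive if [u], [y], [v] are never heads. *)
Lemma rotation_triple C u y v a b q :
  u \notin rotation_heads C -> y \notin rotation_heads C ->
  v \notin rotation_heads C -> C = a ++ [:: u, y, v & b] -> rotation C q ->
  exists a' b', q = a' ++ [:: u, y, v & b'] \/ q = a' ++ [:: v, y, u & b'].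
Proof.
move=> uX yX vX defC; elim=> [|x a1 w b1 rC [a' [b' IH]] fxw].
  by exists a, b; left.
have hX := rotation_headsS rC fxw.
have key p r : p \notin rotation_heads C -> x :: a1 ++ w :: b1 = a' ++ [:: p, y, r & b'] ->
    exists a2 b2, rev (x :: a1) ++ w :: b1 = a2 ++ [:: p, y, r & b2] \/
      rev (x :: a1) ++ w :: b1 = a2 ++ [:: r, y, p & b2].
  move=> pX; rewrite -cat_cons => /cat_eq_cat[[t E ->]|[t E E']].
    by exists (rev (x :: a1) ++ t), b'; left; rewrite catA.
  have lE : last x a1 = last x t \/ t = [::].
    case: (lastP t) E => [|t' z] E; first by right.
    by left; have := congr1 (last x) E; rewrite /= last_cat !last_rcons.
  case: t E E' lE => [|p1 [|y1 [|r1 t]]] /= E E' lE.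
  - exists (rev (x :: a1)), b'; left; by rewrite E'.
  - by case: E' => Ep _ _; case: lE => // lE; rewrite Ep -lE hX in pX.
  - by case: E' => _ Ey _ _; case: lE => // lE; rewrite Ey -lE hX in yX.
  - case: E' => -> -> -> _; exists (rev t), (rev a' ++ w :: b1); right.
    by rewrite E rev_cat !rev_cons -!cats1 -!catA.
case: IH => /key[] // a2 [b2 [H|H]]; exists a2, b2; by [left|right].
Qed.

(** This is Posa's lemma. If [y] and its two neighbours on the closed-up [C] are never heads, both
    edges at [y] survive all rotations, so one of these neighbours precedes [y] in [x :: q];
    rotating along [x y] makes it a head. *)
Lemma rotation_boundary C x q y : uniq C ->
  rotation C (x :: q) -> f x y -> y \in q ->
  [|| y \in rotation_heads C, next C y \in rotation_heads C |
      prev C y \in rotation_heads C].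
Proof.
move=> uC rC fxy yq; apply: contraT; rewrite !negb_or => /and3P[yX nX pX].
have yC : y \in C by rewrite -(perm_mem (rotation_perm rC)) inE yq orbT.
have hX : forall z c, C = z :: c -> z \in rotation_heads C.
  by move=> z c E; rewrite inE; apply/asboolP; exists c; rewrite -E; apply: Rotation0.
have [c1 [c2 defC]] : exists c1 c2, C = c1 ++ y :: c2.
  by move: yC => /splitPr[c1 c2]; exists c1, c2.
case: (lastP c1) defC => [|{}c1 u] defC; first by rewrite (hX y c2) in yX.
(* If [y] is last in [C], its cyclic successor is the first vertex of [C], which is a head. *)
case: c2 defC => [|v c2] defC.
  have [z [c defC']] : exists z c, C = z :: rcons c y.
    rewrite defC cats1; case: (c1) => [|z c]; first by exists u, [::].
    by exists z, (rcons c u).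
  have nE : next C y = z by rewrite defC' next_rcons // -defC'.
  by rewrite nE (hX _ _ defC') in nX.
rewrite cat_rcons in defC.
have nE : next C y = v.
  by rewrite defC -cat_rcons next_cat_cons // cat_rcons -defC.
have pE : prev C y = u.
  have <- : next C u = y by rewrite defC next_cat_cons // -defC.
  exact: prev_next.
rewrite nE in nX; rewrite pE in pX.
have uq : uniq (x :: q) by rewrite (perm_uniq (rotation_perm rC)).
have [a' [b' E]] := rotation_triple pX yX nX defC rC.
case/splitPr: yq rC uq E => a b rC uq E.
have lX := rotation_headsS rC fxy.
rewrite -cat_cons in uq E.
by case: E => E; have := uq; rewrite E -cat_rcons => /uniq_cat_cons_inj-/(_ (x :: a) b);
  rewrite cat_rcons -E => /(_ erefl) /(congr1 (last x)); rewrite last_rcons /= => lE;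
  move: pX nX; rewrite lE lX.
Qed.

End Posa.

(** * Long cycles with a chord *)

Section PosaCycle.
Local Open Scope nat_scope.
Variables (T : finType) (f : rel T).
Hypotheses (fsym : symmetric f) (firr : irreflexive f).

(* A longest path whose first vertex [x] has a neighbour as far along as possible:
   the heads of all rotations of [x :: c] then have all their neighbours in it. *)
Lemma exists_extremal_path : (exists x y, f x y) ->
  exists x c R, [/\ uniq (x :: c ++ R), sorted f (x :: c ++ R), f x (last x c) &
    forall q y z, uniq (y :: q) -> sorted f (y :: q) -> size q = size (c ++ R) ->
      f y z -> z \in take (size c) q].
Proof.
move=> [x0 [y0 f00]].
(* Since [j < size s < M], the weight [size s * M + j] orders the pairs [(size s, j)]
   lexicographically. *)
pose M := #|T|.+1.
pose P w := `[< exists x s j, [/\ uniq (x :: s), sorted f (x :: s), j < size s,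
   f x (nth x s j) & w = size s * M + j] >].
have exP : exists w, P w.
  exists M; apply/asboolP; exists x0, [:: y0], 0; split=> //=; rewrite ?f00 //.
    by rewrite inE andbT; apply: contraTneq f00 => <-; rewrite firr.
  by rewrite mul1n addn0.
have usz (x : T) s : uniq (x :: s) -> size s < #|T|.
  by move=> u; rewrite -[(size s).+1]/(size (x :: s)) -(card_uniqP u) max_card.
have Pmax w : P w -> w <= M * M.
  move=> /asboolP[x [s [j [u _ js _ ->]]]]; have su := usz _ _ u.
  apply: (@leq_trans ((size s).+1 * M)); last by rewrite leq_mul2r ltnW ?orbT.
  by rewrite mulSn addnC leq_add2r (leq_trans (ltnW js)) // ltnW // ltnW.
case: (ex_maxnP exP Pmax) => w /asboolP[x [s [j [us ss js fj ->]]]] wmax.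
exists x, (take j.+1 s), (drop j.+1 s); rewrite cat_take_drop; split=> //.
  by rewrite (take_nth x) // last_rcons.
move=> q y z uq sq szq fyz; rewrite size_take.
have -> : (if j.+1 < size s then j.+1 else size s) = j.+1.
  by case: ltnP => // h; apply/eqP; rewrite eqn_leq h js.
(* Otherwise prepending [z] would give a longer path. *)
have zq : z \in q.
  apply: contraT => zq.
  have /wmax : P ((size q).+1 * M + 0).
    apply/asboolP; exists z, (y :: q), 0; split=> //.
    - rewrite cons_uniq uq inE negb_or zq !andbT.
      by apply: contraTneq fyz => ->; rewrite firr.
    - by rewrite /= fsym fyz; move: sq => /= ->.
    - by rewrite /= fsym.
  rewrite szq addn0 mulSn addnC leq_add2l leqNgt => /negP[].
  by rewrite (ltn_trans js) // ltnW // ltnS; apply: usz us.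
have /wmax : P (size q * M + index z q).
  by apply/asboolP; exists y, q, (index z q); rewrite index_mem nth_index.
rewrite szq leq_add2l => lej.
by rewrite in_take // ltnS.
Qed.

Lemma long_cycle_chord (d N : nat) : 2 < d -> (exists x y, f x y) ->
  (forall x y, f x y -> d <= \sum_z f x z) ->
  (forall Y : {set T}, 0 < #|Y| <= N -> 3 * nedges f Y < d * #|Y|) ->
  exists x c, [/\ uniq (x :: c), cycle f (x :: c), N <= size c &
    exists r, [/\ 1 < r, r < size c & f x (nth x (x :: c) r)]].
Proof.
move=> d3 /exists_extremal_path[x [c [R [us ss fx Hmax]]]] Hd sparse.
set C := x :: c.
have us' : uniq (C ++ R) by [].
have uC : uniq C by move: us'; rewrite cat_uniq => /and3P[].
have nbr y q z : rotation f C (y :: q) -> f y z -> z \in q.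
  move=> rC fyz; have pC := rotation_perm rC.
  have := Hmax (q ++ R) y z; rewrite take_size_cat; last first.
    by have := perm_size pC => -[].
  apply=> //.
  - have -> : y :: q ++ R = (y :: q) ++ R by [].
    by rewrite (perm_uniq (s2 := C ++ R)) // perm_cat2r.
  - exact: (rotation_sorted fsym (R := R) rC).
  - by have := perm_size pC => -[]; rewrite !size_cat => ->.
have nbrx z : f x z -> z \in c by apply: nbr; apply: Rotation0.
have cC : cycle f C.
  rewrite /= rcons_path fsym fx andbT.
  by move: ss; rewrite /= cat_path => /andP[].
exists x, c; split=> //.
  pose X := rotation_heads f C.
  have XP y : y \in X -> exists q, rotation f C (y :: q) by rewrite inE => /asboolP.
  (* By [rotation_boundary], [Y] contains all neighbours of heads. As [#|Y| <= 3 * #|X|], it is too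
     dense to have at most [N] vertices, and it lies inside the cycle. *)
  pose Y := X :|: [set next C y | y in X] :|: [set prev C y | y in X].
  have bY y z : y \in X -> f y z -> z \in Y.
    move=> /XP[q rC] fyz; rewrite !inE.
    case/or3P: (rotation_boundary uC rC fyz (nbr _ _ _ rC fyz)) => H.
    - by move: H; rewrite inE => ->.
    - apply/orP; right; apply/imsetP; exists (next C z) => //; by rewrite prev_next.
    - apply/orP; left; apply/orP; right; apply/imsetP; exists (prev C z) => //.
      by rewrite next_prev.
  have XC y : y \in X -> y \in C.
    by move=> /XP[q rC]; rewrite -(perm_mem (rotation_perm rC)) mem_head.
  have xX : x \in X by rewrite inE; apply/asboolP; exists c; apply: Rotation0.
  have YC : #|Y| <= size C.
    rewrite -(card_uniqP uC); apply/subset_leq_card/fintype.subsetP => y.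
    rewrite !finset.in_setU -orbA => /or3P[H|/imsetP[z zX ->]|/imsetP[z zX ->]].
    - exact: XC.
    - by rewrite mem_next XC.
    - by rewrite mem_prev XC.
  have Y3 : #|Y| <= 3 * #|X|.
    have h1 := leq_imset_card (next C) (mem X).
    have h2 := leq_imset_card (prev C) (mem X).
    rewrite (_ : 3 * #|X| = #|X| + #|X| + #|X|); last by rewrite !mulSn addn0 addnA.
    apply: leq_trans (leq_card_setU _ _).1 _; apply: leq_add h2.
    by apply: leq_trans (leq_card_setU _ _).1 _; apply: leq_add h1.
  have Y0 : 0 < #|Y| by apply/card_gt0P; exists x; rewrite !inE; move: xX; rewrite inE => ->.
  rewrite leqNgt; apply/negP => cN.
  have := sparse Y; rewrite Y0 /= => /(_ (leq_trans YC cN)).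
  have EX : d * #|X| <= nedges f Y.
    have XY : X \subset Y by rewrite /Y -finset.setUA finset.subsetUl.
    rewrite mulnC -sum_nat_const.
    apply: (@leq_trans (\sum_(y in X) \sum_(z in Y) f y z)).
      apply: leq_sum => y yX; have [q rC] := XP _ yX.
      have [z fyz] : exists z, f y z.
        have := XC _ yX => yC; exists (next C y); exact: next_cycle.
      apply: (leq_trans (Hd _ _ fyz)).
      rewrite [leqRHS]big_mkcond; apply: leq_sum => w _.
      by case: (boolP (f y w)) => // /(bY _ _ yX) ->.
    rewrite /nedges [leqRHS](bigID (mem X)) /=.
    apply: leq_trans (leq_addr _ _); rewrite [leqRHS](eq_bigl (mem X)) // => y.
    by rewrite /= andb_idl // => /(fintype.subsetP XY).
  by nia.
(* All neighbours of [x] lie in [c]; without a chord they are only the first and the last entry of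
   [c], against [2 < d]. *)
apply: contrapT => /forallNP nochord.
have := Hd _ _ fx; rewrite leqNgt => /negP; apply.
apply: leq_ltn_trans d3.
rewrite -big_mkcond /= sum1_card.
apply: leq_trans (_ : #|[set nth x c 0; last x c]| <= 2); last first.
  by rewrite cards2; case: (_ != _).
apply/subset_leq_card/fintype.subsetP => z fxz; rewrite !inE.
have zc := nbrx _ fxz.
have [iz|iz] := posnP (index z c).
  by rewrite -iz nth_index // eqxx.
apply: contraT; rewrite negb_or => /andP[_ zl].
case: (nochord (index z c).+1); split=> //=; last by rewrite nth_index.
rewrite -index_mem in zc; rewrite ltn_neqAle zc andbT.
apply: contraNneq zl => E; rewrite -nth_last -E /=.
by rewrite nth_index // -index_mem.
Qed.

End PosaCycle.

(** * Paths in a cycle with a chord *)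

Section Theta.
Variables (T : eqType) (e : rel T).
Hypothesis (esym : symmetric e).
Variables (C : int -> T) (n r : nat).
Hypothesis Cper : forall z : int, C (z + n%:Z) = C z.
Hypothesis Cinj : forall z w, C z = C w -> `|z - w| < n%:Z -> z = w.
Hypothesis Cadj : forall z : int, e (C z) (C (z + 1)).
Hypothesis (r_gt1 : (1 < r)%N) (r_ltn : (r.+1 < n)%N).
Hypothesis chord : e (C 0) (C r%:Z).

(* If every path of length [t] has ends of the same colour, the colouring is
   periodic along the cycle, with least period [m] say.  Paths of length [t] through
   the chord [0 - r] leave its ends in the same or in opposite directions: the
   former make [r - 1] or [n - r - 1] a period, the latter give the reflections
   [z -> r + 1 - z] and [z -> r - 1 - z], hence the period [2]. *)
Lemma theta_path (chi : pred T) (t : nat) : (0 < t < n)%N ->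
  (exists z w, chi (C z) != chi (C w)) ->
  (exists z : int, chi (C z) = chi (C (z + 1))) ->
  exists g : nat -> int,
    [/\ forall i j, (i < j <= t)%N -> C (g i) != C (g j),
        forall j, (j < t)%N -> e (C (g j)) (C (g j.+1)) &
        chi (C (g 0%N)) != chi (C (g t))].
Proof.
move=> /andP[t0 tn] [z0 [w0 nconst]] [z1 nalt]; apply: contrapT => /forallNP nopath.
pose F z := chi (C z).
have Fn (z : int) : F (z + n%:Z) = F z by rewrite /F Cper.
have Cadj' (z : int) : e (C (z + 1)) (C z) by rewrite esym.
have Ft (z : int) : F (z + t%:Z) = F z.
  apply: contrapT => Fz; case: (nopath (fun j => z + j%:Z)); split.
  - move=> i j ij; apply/eqP => /Cinj; lia.
  - move=> j _; rewrite (_ : z + j.+1%:Z = z + j%:Z + 1) ?Cadj //; lia.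
  - by rewrite addr0 eq_sym; apply/eqP.
(* The path runs [a] steps to [0], crosses the chord to [r], and takes [b] further steps; the signs
   say on which side of [0] and of [r] the two parts lie. The inequality keeps these parts
   disjoint. *)
have Fchord (s1 s2 : bool) (a b : nat) : (a + b + 1 = t)%N ->
    (forall i j, (i <= a)%N -> (j <= b)%N ->
       0 < r%:Z + (-1) ^+ s2 * j%:Z - (-1) ^+ s1 * i%:Z < n%:Z) ->
    F ((-1) ^+ s1 * a%:Z) = F (r%:Z + (-1) ^+ s2 * b%:Z).
  move=> abt H; apply: contrapT => FE.
  pose g (j : nat) : int := if (j <= a)%N then (-1) ^+ s1 * (a%:Z - j%:Z)
     else r%:Z + (-1) ^+ s2 * (j%:Z - a%:Z - 1).
  case: (nopath g); split.
  - move=> i j ij; rewrite /g; apply/eqP.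
    case: (leqP i a) => ia; case: (leqP j a) => ja.
    + by move/Cinj; case: (s1); rewrite ?expr1 ?expr0; lia.
    + move/Cinj; have := H (a - i)%N (j - a - 1)%N.
      have -> : (a - i)%N%:Z = a%:Z - i%:Z by lia.
      have -> : (j - a - 1)%N%:Z = j%:Z - a%:Z - 1 by lia.
      lia.
    + lia.
    + by move/Cinj; case: (s2); rewrite ?expr1 ?expr0; lia.
  - move=> j jt; rewrite /g.
    have [ja|[ja|ja]] : (j < a)%N \/ (a < j)%N \/ j = a by lia.
    + rewrite ltnW // ja; case: (s1); rewrite ?expr1 ?expr0.
        rewrite (_ : -1 * (a%:Z - j.+1%:Z) = -1 * (a%:Z - j%:Z) + 1) //; lia.
      rewrite (_ : 1 * (a%:Z - j%:Z) = 1 * (a%:Z - j.+1%:Z) + 1) //; lia.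
    + rewrite leqNgt ja (leqNgt j.+1 a) ltnS (ltnW ja) /=.
      case: (s2); rewrite ?expr1 ?expr0.
        rewrite (_ : r%:Z + -1 * (j%:Z - a%:Z - 1) =
          r%:Z + -1 * (j.+1%:Z - a%:Z - 1) + 1) //; lia.
      rewrite (_ : r%:Z + 1 * (j.+1%:Z - a%:Z - 1) =
          r%:Z + 1 * (j%:Z - a%:Z - 1) + 1) //; lia.
    + rewrite ja leqnn ltnn subrr mulr0.
      by rewrite (_ : a.+1%:Z - a%:Z - 1 = 0) ?mulr0 ?addr0 //; lia.
  - rewrite /g leq0n subr0 leqNgt (_ : (a < t)%N); last by lia.
    by rewrite (_ : t%:Z - a%:Z - 1 = b%:Z); [apply/eqP | lia].
pose per m := (0 < m)%N && `[< forall z : int, F (z + m%:Z) = F z >].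
have exper : exists m, per m.
  by exists n; apply/andP; split; [lia | apply/asboolP].
case: (ex_minnP exper) => m /andP[m0 /asboolP Fm] mmin.
have minp p : (0 < p)%N -> (forall z : int, F (z + p%:Z) = F z) -> (m <= p)%N.
  by move=> p0 Fp; apply: mmin; rewrite /per p0; apply/asboolP.
have FmN (q : nat) (z : int) : F (z + q%:Z * m%:Z) = F z.
  elim: q => [|q IH]; first by rewrite mul0r addr0.
  by rewrite -{}IH -(Fm (z + q%:Z * m%:Z)); congr F; lia.
have FmZ (q z : int) : F (z + q * m%:Z) = F z.
  case: q => q; first exact: FmN.
  by rewrite -(FmN q.+1); congr F; rewrite NegzE; lia.
(* Since [m] is a period, an argument of [F] may be moved into any window of [m] consecutive
   integers, chosen below so that the path through the chord is simple. *)
have choose (lo : nat) (x : int) : exists a : nat,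
    (lo <= a < lo + m)%N /\ exists q, x = a%:Z + q * m%:Z.
  have m0' : 0 < m%:Z by [].
  have m0'' : m%:Z != 0 by lia.
  have h1 := modz_ge0 (x - lo%:Z) m0''.
  have h2 := ltz_pmod (x - lo%:Z) m0'.
  have h3 := divz_eq (x - lo%:Z) m%:Z.
  exists (lo + `|((x - lo%:Z) %% m%:Z)%Z|)%N; split; first by lia.
  exists ((x - lo%:Z) %/ m%:Z)%Z; lia.
(* Period 1 means a constant colouring, and period 2 a constant or alternating one. *)
have m3 : (2 < m)%N.
  rewrite ltnNge; apply/negP => m2.
  have m12 : m = 1%N \/ m = 2%N by lia.
  case: m12 => mE; subst m.
    have F0 z : F z = F 0 by rewrite -(FmZ z 0); congr F; lia.
    by move: nconst; rewrite -/(F z0) -/(F w0) !(F0 _, F0 w0) eqxx.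
  have F01 z : exists b : bool, z = b%:Z + (z %/ 2)%Z * 2%:Z.
    have := divz_eq z 2; have := modz_ge0 z (isT : 2%:Z != 0).
    have := ltz_pmod z (isT : 0 < 2%:Z) => h1 h2 h3.
    have [h|h] : (z %% 2 = 0)%Z \/ (z %% 2 = 1)%Z by lia.
      by exists false; lia.
    by exists true; lia.
  have Fb (b : bool) (q : int) : F (b%:Z + q * 2%:Z) = F b%:Z by apply: FmZ.
  have F10 : F 0 != F 1.
    apply: contraNneq nconst => E; rewrite -/(F z0) -/(F w0).
    have [b ->] := F01 z0; have [b' ->] := F01 w0; rewrite !Fb.
    by apply/eqP; case: (b); case: (b').
  have [b E] := F01 z1; move: nalt; rewrite -/(F z1) -/(F _).
  have E' : z1 + 1 = (~~ b)%:Z + ((z1 %/ 2)%Z + b%:Z) * 2%:Z by case: (b) E; lia.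
  by rewrite E' {1}E !Fb; move/eqP: F10; case: (b) => /= h1 h2; apply: h1.
have mt : (m <= t)%N by apply: minp.
have mnt : (m <= n - t)%N.
  apply: minp => [|z]; first by lia.
  by rewrite -Ft -(Fn z); congr F; lia.
(* For [r < m], both parts of the path go into the arc from [r] to [n], and [r - 1] becomes a period
   below [m]. *)
have [rm|mr] := ltnP r m.
  suff : (m <= r - 1)%N by lia.
  apply: minp => [|z]; first by lia.
  have [a [/andP[_ am] [q E]]] := choose 0%N (- z).
  have -> : z = (-1) ^+ true * a%:Z + (- q) * m%:Z by rewrite expr1; lia.
  rewrite addrAC !FmZ (Fchord true false a (t - 1 - a)%N); [|by lia|].
    by rewrite -(Ft (_ + (r - 1)%N%:Z)); congr F; rewrite expr1 expr0; lia.
  by move=> i j ia jb; rewrite expr1 expr0; lia.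
(* For [n - r < m], both parts go into the arc from [0] to [r]. Then [r + 1] is a period, hence so
   is [n - r - 1]. *)
have [nrm|mnr] := ltnP (n - r) m.
  suff : (m <= n - r - 1)%N by lia.
  apply: minp => [|z]; first by lia.
  suff -> : F (z + (n - r - 1)%N%:Z) = F (z + (n - r - 1)%N%:Z + r%:Z + 1).
    by rewrite -(Fn z); congr F; lia.
  move: (z + _) => {}z.
  have [a [/andP[_ am] [q E]]] := choose 0%N z.
  rewrite {}E; have -> : a%:Z + q * m%:Z + r%:Z + 1 = a%:Z + r%:Z + 1 + q * m%:Z by lia.
  rewrite !FmZ.
  have := Fchord false true a (t - 1 - a)%N; rewrite expr1 expr0 mul1r => ->; [|by lia|].
    by rewrite -Ft; congr F; lia.
  by move=> i j ia jb; lia.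
(* The window starts at [t - r] so that the part descending from [r] stops before [0]; the other
   part fits because [m <= n - t] and [m <= n - r]. *)
have refl1 (z : int) : F z = F (r%:Z + 1 - z).
  have [a [/andP[lea am] [q E]]] := choose (t - r)%N (- z).
  have -> : z = - a%:Z + (- q) * m%:Z by lia.
  have -> : r%:Z + 1 - (- a%:Z + (- q) * m%:Z) = r%:Z + 1 + a%:Z + q * m%:Z by lia.
  rewrite !FmZ.
  have := Fchord true true a (t - 1 - a)%N; rewrite expr1 mulN1r => ->; [|by lia|].
    by rewrite -Ft; congr F; lia.
  by move=> i j ia jb; lia.
have refl2 (z : int) : F z = F (r%:Z - 1 - z).
  have [a [/andP[lea am] [q E]]] := choose (t - (n - r))%N z.
  rewrite {}E; have -> : r%:Z - 1 - (a%:Z + q * m%:Z) = r%:Z - 1 - a%:Z + (- q) * m%:Z by lia.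
  rewrite !FmZ.
  have := Fchord false false a (t - 1 - a)%N; rewrite expr0 !mul1r => ->; [|by lia|].
    by rewrite -(Ft (_ - a%:Z)); congr F; lia.
  by move=> i j ia jb; lia.
suff : (m <= 2)%N by lia.
apply: minp => // z.
by rewrite (refl1 (z + 2)) refl2; congr F; lia.
Qed.

End Theta.

(** * Closing paths through the search tree *)

Section ConsecutiveCycles.
Local Open Scope nat_scope.

Lemma has_cycle_fun (T : finType) (e : rel T) (g : nat -> T) n :
  3 <= n -> g n = g 0 -> (forall j, j < n -> e (g j) (g j.+1)) ->
  (forall i j, i < j < n -> g i != g j) -> has_cycle e n.
Proof.
move=> n3 gn ge gi; apply/has_cycleP; exists (mkseq g n); split=> //.
- by rewrite size_mkseq.
- rewrite map_inj_in_uniq ?iota_uniq // => i j.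
  rewrite !mem_iota !add0n => /andP[_ iN] /andP[_ jN] gE.
  case: (ltngtP i j) => // ij.
    by have := gi i j; rewrite ij jN gE eqxx => /(_ isT).
  by have := gi j i; rewrite ij iN gE eqxx => /(_ isT).
- case: n n3 gn ge {gi} => // n _ gn ge.
  rewrite /= -{2}gn -map_rcons -[rcons _ _]cats1 -[[:: n.+1]]/(iota (1 + n) 1) -iotaD addn1.
  have key m a : a + m <= n.+1 -> path e (g a) [seq g i | i <- iota a.+1 m].
    elim: m a => //= m IH a ltm; rewrite ge ?IH //; lia.
  exact: (key n.+1 0).
Qed.

(** Indexing by all integers, with the length as period, makes an arc in either direction an
    interval of integers. *)
Lemma cycle_indexing (T : eqType) (f : rel T) x c :
  uniq (x :: c) -> cycle f (x :: c) ->
  exists C : int -> T,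
    [/\ forall z : int, C (z + (size c).+1%:Z)%R = C z,
        forall z w : int, C z = C w -> (`|z - w| < (size c).+1%:Z)%R -> z = w,
        forall z : int, f (C z) (C (z + 1)%R),
        forall j, j < (size c).+1 -> C j%:Z = nth x (x :: c) j &
        forall z : int, C z \in x :: c].
Proof.
move=> us cs; pose s := x :: c.
pose n := size s.
pose C (z : int) := nth x s `|(z %% n%:Z)%Z|.
have n0 : (n%:Z != 0)%R by [].
have modn_lt (z : int) : `|(z %% n%:Z)%Z| < n.
  have := modz_ge0 z n0; have : (0 < n%:Z)%R by [].
  by move/(ltz_pmod z); lia.
have CE j : j < n -> C j%:Z = nth x s j.
  by move=> jn; rewrite /C modz_small ?absz_nat //; lia.
have Cs (z : int) : C z \in s by apply: mem_nth; apply: modn_lt.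
have Cper (z : int) : C (z + n%:Z)%R = C z by rewrite /C modzDr.
have Cinj (z w : int) : C z = C w -> (`|z - w| < n%:Z)%R -> z = w.
  move=> /eqP; rewrite nth_uniq ?modn_lt // => /eqP E.
  have := modz_ge0 z n0; have := modz_ge0 w n0 => h1 h2 zw.
  have : (z == w %[mod n%:Z])%Z by apply/eqP; lia.
  rewrite eqz_mod_dvd => /dvdzP[q qE].
  by case: q qE => [[|q]|q] qE; nia.
have CperZ (q w : int) : C (q * n%:Z + w)%R = C w by rewrite /C modzMDl.
have Cnat j : j < n -> f (C j%:Z) (C j.+1%:Z).
  move=> jn; move: (cs) => /= /(pathP x) /(_ j); rewrite size_rcons => /(_ jn).
  rewrite CE // -rcons_cons nth_rcons [size (x :: c)]/= -[(size c).+1]/n jn.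
  rewrite nth_rcons; have [jc|jc] := ltnP j (size c); first by rewrite (CE j.+1).
  have -> : j.+1 = n by apply/eqP; rewrite eqn_leq jn /n ltnS jc.
  by rewrite if_same -[n%:Z]add0r Cper (CE 0).
have Cadj (z : int) : f (C z) (C (z + 1)%R).
  have := Cnat _ (modn_lt z).
  have E : z = ((z %/ n%:Z)%Z * n%:Z + `|(z %% n%:Z)%Z|%:Z)%R.
    by have := divz_eq z n%:Z; have := modz_ge0 z n0; lia.
  by rewrite {4}E -addrA CperZ {3}E CperZ -addn1 PoszD.
by exists C; split.
Qed.

Lemma level_ancestor (T : Type) (e : rel T) (lev : T -> nat) (par : T -> T) :
  (forall x, 0 < lev x -> e x (par x) /\ lev x = (lev (par x)).+1) ->
  forall v j, j <= lev v -> lev (iter j par v) = lev v - j.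
Proof.
move=> levpar v; elim=> [|j IH] jv; first by rewrite subn0.
have := IH (ltnW jv); have [|_] := levpar (iter j par v).
  by rewrite IH ?(ltnW jv) // subn_gt0.
by rewrite iterS; lia.
Qed.

Lemma ancestor_edge (T : Type) (e : rel T) (lev : T -> nat) (par : T -> T) :
  (forall x, 0 < lev x -> e x (par x) /\ lev x = (lev (par x)).+1) ->
  forall v j, j < lev v -> e (iter j par v) (iter j.+1 par v).
Proof.
move=> levpar v j jv; have [|//] := levpar (iter j par v).
by rewrite (level_ancestor levpar) ?(ltnW jv) // subn_gt0.
Qed.

(** The path stays at levels at least [i] and the tree vertices added lie strictly below level [i].
    The two branches are disjoint, since a common vertex below height [h] would force equal
    ancestors at height [h.-1]. *)
Lemma cycle_through_tree (T : finType) (e : rel T) (lev : T -> nat) (par : T -> T)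
    (g : nat -> T) (i h t : nat) : symmetric e ->
  (forall x, 0 < lev x -> e x (par x) /\ lev x = (lev (par x)).+1) ->
  0 < h <= i -> 0 < t ->
  (forall j1 j2, j1 < j2 <= t -> g j1 != g j2) ->
  (forall j, j < t -> e (g j) (g j.+1)) ->
  (forall j, j <= t -> i <= lev (g j)) ->
  lev (g 0) = i -> lev (g t) = i ->
  iter h par (g 0) = iter h par (g t) ->
  iter h.-1 par (g 0) != iter h.-1 par (g t) ->
  has_cycle e (2 * h + t).
Proof.
move=> es levpar /andP[h0 hi] t0 ginj gadj levg lu lv Quv uvh.
have levpar_iter v0 j : lev v0 = i -> j <= i -> lev (iter j par v0) = i - j.
  by move=> <-; apply: (level_ancestor levpar).
have epar v0 j : lev v0 = i -> j < i -> e (iter j par v0) (iter j.+1 par v0).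
  by move=> <-; apply: (ancestor_edge levpar).
set u := g 0 in lu Quv uvh; set v := g t in lv Quv uvh.
(* Along the path from [u] to [v], then [h] steps up from [v], then down to [u]. *)
pose G j := if j <= t then g j else if j <= t + h then iter (j - t) par v
   else iter (2 * h + t - j) par u.
have GE1 j : j <= t -> G j = g j by rewrite /G => ->.
have GE2 j : t <= j <= t + h -> G j = iter (j - t) par v.
  rewrite /G => /andP[tj ->]; case: ifP => // jt.
  by rewrite (_ : j = t) ?subnn //; lia.
have GE3 j : t + h <= j -> G j = iter (2 * h + t - j) par u.
  move=> thj; rewrite /G (_ : (j <= t) = false); last by lia.
  case: ifP => // jth; have -> : j = t + h by lia.
  have -> : 2 * h + t - (t + h) = h by lia.
  by rewrite addKn Quv.
apply: (@has_cycle_fun _ _ G).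
- lia.
- by rewrite GE3 ?GE1 //; [rewrite subnn | lia].
- move=> j jn; have [jt|jt] := ltnP j t.
    by rewrite !GE1 ?(ltnW jt) //; apply: gadj.
  have [jth|jth] := ltnP j (t + h).
    rewrite !GE2; [|lia|lia].
    by rewrite subSn //; apply: epar => //; lia.
  rewrite !GE3; [|lia|lia]; rewrite es.
  have -> : 2 * h + t - j = (2 * h + t - j.+1).+1 by lia.
  by apply: epar => //; lia.
move=> j1 j2 /andP[j12 j2n].
have [j2t|j2t] := leqP j2 t.
  by rewrite !GE1 //; [apply: ginj; rewrite j12 | lia].
have levG2 : lev (G j2) = i - (if j2 <= t + h then j2 - t else 2 * h + t - j2).
  by rewrite /G leqNgt j2t /=; case: ifP => H; apply: levpar_iter => //; lia.
have [j1t|j1t] := leqP j1 t.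
  apply/eqP => E; have := levg _ j1t; rewrite -GE1 // E levG2.
  by case: ifP; lia.
have levG1 : lev (G j1) = i - (if j1 <= t + h then j1 - t else 2 * h + t - j1).
  by rewrite /G leqNgt j1t /=; case: ifP => H; apply: levpar_iter => //; lia.
apply/eqP => E; have := levG2; rewrite -E levG1.
have [j2h|j2h] := leqP j2 (t + h).
  by case: ifP; lia.
have [j1h|j1h] := leqP j1 (t + h); last by lia.
move=> lE; have jE : j1 - t = 2 * h + t - j2 by lia.
move: E; rewrite GE2 ?GE3; [|lia|lia]; rewrite jE.
move=> /(congr1 (iter (h.-1 - (2 * h + t - j2)) par)).
rewrite -!iterD subnK; last by lia.
by move=> E; move: uvh; rewrite E eqxx.
Qed.

(** The height [h] is the least at which all level-[i] vertices of the cycle have the same ancestor.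
    It depends on the cycle only, so varying the path length yields consecutive even lengths. *)
Lemma even_cycles_of_chord (T : finType) (e f : rel T) (lev : T -> nat)
    (par : T -> T) (i r : nat) (x : T) (c : seq T) : symmetric e ->
  (forall x, 0 < lev x -> e x (par x) /\ lev x = (lev (par x)).+1) ->
  (forall x y, connect e x y -> lev x = 0 -> lev y = 0 -> x = y) ->
  (forall x y, e x y -> lev y = (lev x).+1 \/ lev x = (lev y).+1) ->
  symmetric f -> (forall x y, f x y -> e x y) ->
  (forall x y, f x y -> minn (lev x) (lev y) = i) ->
  uniq (x :: c) -> cycle f (x :: c) -> 4 <= size c ->
  1 < r < size c -> f x (nth x (x :: c) r) ->
  exists h, forall j, 0 < j -> 2 * j <= size c -> has_cycle e (2 * h + 2 * j).
Proof.
move=> es levpar lev0 hlev fsym fe fmin us cs c4 /andP[r1 rc] fr.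
have flev u v : f u v -> i <= lev u <= i.+1.
  by move=> fuv; have := fmin _ _ fuv; have := hlev _ _ (fe _ _ fuv); lia.
have [C [Cper Cinj Cadj CE Cs]] := cycle_indexing us cs.
set n := (size c).+1 in Cper Cinj CE.
set s := x :: c in us cs fr CE Cs.
have sC y : y \in s -> exists z, C z = y.
  by move=> ys; exists (index y s)%:Z; rewrite CE ?nth_index ?index_mem.
have Ccon (v w : T) : v \in s -> w \in s -> connect e v w.
  have csx y : y \in s -> connect e x y.
    move=> ys; apply: (path_connect (p := rcons c x)); last by rewrite inE mem_rcons ys orbT.
    exact: (@sub_path _ f e fe x (rcons c x) cs).
  by move=> /csx vs /csx; apply: connect_trans; rewrite (sym_connect_sym es).
pose A0 := [set v in s | lev v == i].
have A0P v : v \in A0 -> v \in s /\ lev v = i by rewrite inE => /andP[? /eqP].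
have con_iter v j : lev v = i -> j <= i -> connect e v (iter j par v).
  move=> lv; elim: j => [|j IH] ji; first exact: connect0.
  by apply: connect_trans (IH (ltnW ji)) (connect1 _); apply: (ancestor_edge levpar); rewrite lv.
pose Q h := [forall v in A0, forall w in A0, iter h par v == iter h par w].
have Qi : Q i.
  apply/forall_inP => v /A0P[vs lv]; apply/forall_inP => w /A0P[ws lw].
  apply/eqP; apply: lev0; rewrite ?(level_ancestor levpar) ?lv ?lw ?subnn //.
  apply: connect_trans (con_iter _ _ lw (leqnn i)).
  apply: connect_trans (Ccon _ _ vs ws).
  by rewrite (sym_connect_sym es) con_iter.
case: (ex_minnP (ex_intro Q i Qi)) => h Qh hmin.
have hi : h <= i by apply: hmin.
have {}Qh v w : v \in A0 -> w \in A0 -> iter h par v = iter h par w.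
  by move=> vA wA; apply/eqP; move: Qh => /forall_inP/(_ v vA)/forall_inP/(_ w wA).
(* For [h = 0] only one vertex of the cycle would lie on level [i], but each of the pairs [C 0, C 1]
   and [C 2, C 3] has one, and the cycle has at least five vertices. *)
have [h0|h0] := posnP h.
  have near (z : int) : C z \in A0 \/ C (z + 1)%R \in A0.
    have mE := fmin _ _ (Cadj z); rewrite !finset.in_set !Cs /=.
    have [E|E] : lev (C z) = i \/ lev (C (z + 1)%R) = i by lia.
      by left; apply/eqP.
    by right; apply/eqP.
  move: Qh; rewrite h0 /= => Qh.
  by have [a0A|a0A] := near 0%R; have [b0A|b0A] := near 2%R;
    have := Cinj _ _ (Qh _ _ a0A b0A); move: c4; clear; lia.
have : ~~ Q h.-1 by apply/negP => /hmin; lia.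
rewrite negb_forall_in => /exists_inP[a0 a0A].
rewrite negb_forall_in => /exists_inP[b0 b0A ab].
pose chi : pred T := [pred v | (lev v == i) && (iter h.-1 par v == iter h.-1 par a0)].
exists h => i0 i01 i0c.
have tn : 0 < 2 * i0 < n.
  by rewrite muln_gt0 i01 /n ltnS.
have [z0 z0E] := sC _ (A0P _ a0A).1.
have [z1 z1E] := sC _ (A0P _ b0A).1.
have r_lt : r.+1 < n by rewrite /n /= ltnS.
have Cr : f (C 0%R) (C r%:Z) by rewrite (CE 0 isT) (CE r (ltnW r_lt)).
have [||g [ginj gadj gchi]] := theta_path fsym Cper Cinj Cadj r1 r_lt Cr (chi := chi) tn.
- exists z0, z1; rewrite z0E z1E /chi /= !(A0P _ _).2 // !eqxx /=.
  by rewrite [iter _ _ b0 == _]eq_sym (negbTE ab).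
(* The vertex [b0] is uncoloured, and so is its successor, being on level [i.+1]; hence the
   colouring does not alternate. *)
- exists z1; have := Cadj z1; rewrite z1E /chi /= (A0P _ b0A).2 eqxx.
  rewrite [iter _ _ b0 == _]eq_sym (negbTE ab) /=.
  move=> fb; have := hlev _ _ (fe _ _ fb); have := fmin _ _ fb; rewrite (A0P _ b0A).2 => h2 h1.
  by rewrite gtn_eqF //; move: h1 h2; clear; lia.
set t := 2 * i0 in tn ginj gadj gchi *.
have levg j : i <= lev (C (g j)) <= i.+1 by apply: flev (Cadj (g j)).
have oddg j : j <= t -> odd (lev (C (g j))) = odd (lev (C (g 0))) (+) odd j.
  elim: j => [|j IH] jt; first by rewrite addbF.
  have /fe/hlev[E|E] := gadj j jt; have := IH (ltnW jt).
    by rewrite E /= => ->; rewrite addbN.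
  by rewrite E /= addbN => <-; rewrite negbK.
(* An even path has ends on the same level, and the end satisfying [chi] is on level [i]. *)
have [u0 v0] : C (g 0) \in A0 /\ C (g t) \in A0.
  rewrite !finset.in_set !Cs /=.
  have := oddg t (leqnn t); rewrite /t mul2n odd_double addbF -mul2n -/t.
  move=> lo; have lcase j : lev (C (g j)) = i \/ lev (C (g j)) = i.+1.
    by move: (levg j); clear; lia.
  have lE : lev (C (g t)) = lev (C (g 0)).
    by case: (lcase t) (lcase 0) lo => -> [] -> //=; case: (odd i).
  by move: gchi; rewrite /chi /= lE; case: (lev _ == i).
have uvh : iter h.-1 par (C (g 0)) != iter h.-1 par (C (g t)).
  apply: contraNneq gchi => E.
  by rewrite /chi /= (A0P _ u0).2 (A0P _ v0).2 E.
rewrite /t.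
apply: (cycle_through_tree (lev := lev) (par := par) (g := C \o g) (i := i)) => //=.
- by rewrite h0.
- by case/andP: tn.
- by move=> j /gadj/fe.
- by move=> j _; case/andP: (levg j).
- exact: (A0P _ u0).2.
- exact: (A0P _ v0).2.
- exact: Qh.
Qed.

Lemma consecutive_even_cycles (T : finType) (e : rel T) (d k : nat) :
  simple_graph e -> bipartite e -> 2 < d -> 1 < k ->
  (forall Y : {set T}, 0 < #|Y| <= 2 * k -> 3 * nedges e Y < d * #|Y|) ->
  4 * d * #|T| < nedges e [set: T] ->
  exists m, forall i, 1 <= i <= k -> has_cycle e (2 * m + 2 * i).
Proof.
move=> /simple_graphP[ei es] be d3 k1 sparse dense.
have [lev [par [lev1 levpar lev0]]] := exists_levels es.
have hlev := bipartite_levels es be lev1 levpar lev0.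
have [i [W [W0 Wdeg]]] := dense_layer es ei hlev dense.
pose f := [rel x y | [&& e x y, minn (lev x) (lev y) == i, x \in W & y \in W]].
have fsym : symmetric f by move=> x y; rewrite /f /= es minnC (andbC (y \in W)).
have firr : irreflexive f by move=> x; rewrite /f /= ei.
have fe x y : f x y -> e x y by case/andP.
have fmin x y : f x y -> minn (lev x) (lev y) = i by case/and3P => _ /eqP.
have Wsum x : x \in W ->
    \sum_(y in W) (e x y && (minn (lev x) (lev y) == i)) = \sum_y f x y.
  move=> xW; rewrite big_mkcond; apply: eq_bigr => y _; rewrite /f /= xW.
  by case: (y \in W); rewrite ?andbT ?andbF.
have fdeg x y : f x y -> d <= \sum_z f x z.
  by move=> /and4P[_ _ xW _]; rewrite -Wsum // Wdeg.
have fex : exists x y, f x y.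
  have /set0Pn[x xW] := W0; exists x; apply: contrapT => /forallNP nof.
  have := Wdeg _ xW; rewrite Wsum // big1 => [|y _]; first by lia.
  by apply/eqP; rewrite eqb0; apply/negP; apply: nof.
have fsparse (Y : {set T}) : 0 < #|Y| <= 2 * k -> 3 * nedges f Y < d * #|Y|.
  by move/sparse; apply: leq_ltn_trans; rewrite leq_mul2l (nedges_sub _ fe) orbT.
have [x [c [us cs kc [r [r1 rc fr]]]]] :=
  long_cycle_chord fsym firr d3 fex fdeg fsparse.
have [||h Hh] := even_cycles_of_chord es levpar lev0 hlev fsym fe fmin us cs _ _ fr.
- by apply: leq_trans kc; rewrite (leq_mul2l 2 2).
- by rewrite r1.
exists h => j /andP[j0 jk]; apply: Hh => //.
by rewrite (leq_trans _ kc) // leq_mul2l jk orbT.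
Qed.

End ConsecutiveCycles.

(** * The infimum and the theorem *)

Section Bridge.
Variables (T : finType) (e : rel T) (v0 : T).

Definition bridge : rel (bool * T)%type := [rel u v |
  if u.1 == v.1 then e u.2 v.2 else (u.2 == v0) && (v.2 == v0)].

Lemma bridge_simple : simple_graph e -> simple_graph bridge.
Proof.
move=> /simple_graphP[ei es]; apply/simple_graphP; split=> [u|u v].
  by rewrite /bridge /= eqxx ei.
by rewrite /bridge /= eq_sym es andbC.
Qed.

Lemma bridge_nedges :
  nedges bridge [set: bool * T] = (2 * nedges e [set: T] + 2)%N.
Proof.
rewrite !nedgesT.
have E (b : bool) (x : T) : (\sum_y bridge (b, x) y = \sum_y e x y + (x == v0))%N.
  rewrite -(pair_bigA _ (fun c y => nat_of_bool (bridge (b, x) (c, y)))) big_bool.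
  have E1 c : (\sum_y bridge (b, x) (c, y) = if b == c then \sum_y e x y else (x == v0))%N.
    rewrite /bridge /=; case: eqP => // _.
    by rewrite (bigD1 v0) //= eqxx andbT big1 ?addn0 // => y /negbTE ->; rewrite andbF.
  by rewrite !E1; case: (b) => //=; rewrite addnC.
rewrite -(pair_bigA _ (fun b x => \sum_y bridge (b, x) y))%N big_bool /=.
under eq_bigr do rewrite E; under [X in (_ + X)%N]eq_bigr do rewrite E.
rewrite !big_split /=.
have -> : (\sum_x (x == v0) = 1)%N.
  by rewrite (bigD1 v0) //= eqxx big1 // => y /negbTE->.
lia.
Qed.

(** A cycle leaving a copy through the edge joining the copies of [v0] could return only through the
    same edge. So it stays in one copy, and the copy index serves as the label in
    [has_cycle_hom]. *)
Lemma bridge_cycle n : has_cycle bridge n -> has_cycle e n.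
Proof.
move=> /has_cycleP[s [sn n3 us cs]].
have nocross z : z \in s -> z.1 == (next s z).1.
  move=> zs; apply: contraT => cross.
  have [i p Ep] := rot_to zs.
  have us' : uniq (z :: p) by rewrite -Ep rot_uniq.
  have cs' : cycle bridge (z :: p) by rewrite -Ep rot_cycle.
  have sz : size (z :: p) = n by rewrite -Ep size_rot.
  have nx : next s z = next (z :: p) z by rewrite -Ep next_rot.
  case: p {Ep} us' cs' sz nx => [|w p] us' cs' sz nx; first by rewrite -sz in n3.
  rewrite /= eqxx in nx; rewrite {}nx in cross.
  move: cs' => /= /andP[]; rewrite {1}/bridge /= (negbTE cross) => /andP[/eqP z2 /eqP w2] pw.
  (* A path starting in the other copy cannot come back without meeting [z]. *)
  have side q y : path bridge y q -> z \notin q -> y.1 != z.1 ->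
      (last y q).1 != z.1.
    elim: q y => //= y' q IH y /andP[yy' pq]; rewrite inE negb_or => /andP[zy' zq] yz.
    apply: IH => //; move: yy'; rewrite /bridge /=; case: eqP => [<- //|ne /andP[_ /eqP y'2]].
    apply: contra zy' => /eqP E; rewrite -pair_eqE /= eq_sym E eqxx /=.
    by rewrite y'2 z2.
  move: pw; rewrite rcons_path => /andP[pw lz].
  have zp : z \notin p by move: us'; rewrite /= inE negb_or => /andP[/andP[]].
  have := side _ _ pw zp; rewrite eq_sym => /(_ cross) lne.
  move: lz; rewrite /bridge /= (negbTE lne) => /andP[/eqP l2 _].
  have lw : last w p = w.
    apply/eqP; rewrite -pair_eqE /= l2 w2 eqxx andbT.
    by case: (last w p).1 (z.1) (w.1) lne cross => [] [] [].
  case: (lastP p) sz lw us' {pw zp lne l2} => [sz|q y _]; first by rewrite -sz in n3.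
  by rewrite last_rcons => -> /=; rewrite mem_rcons inE eqxx !andbF.
pose e' : rel (bool * T) := [rel u v | (u.1 == v.1) && e u.2 v.2].
apply: (@has_cycle_hom _ _ _ e' e (fun u => u.2) (fun u => u.1)) => //=.
- by move=> u v /andP[].
- by move=> u v /andP[/eqP].
- by move=> [b x] [c y] _ _ _ _ /= -> ->.
apply/has_cycleP; exists s; split=> //.
have := cycle_next us; apply: (sub_in_cycle (P := mem s)); last by apply/allP.
move=> u v us' _ /eqP <-; have := next_cycle cs us'.
by rewrite /bridge /e' /= nocross.
Qed.

End Bridge.

Section Main.
Variables (R : realType) (k l : nat).
Hypotheses (l3 : (3 <= l)%N) (lk : (l < k)%N).
Let k4 : (4 <= k)%N. Proof. exact: leq_ltn_trans l3 lk. Qed.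

Lemma dk_gt0 : 0 < dk R k l.
Proof. by have := dk_lower R l3 k4; lra. Qed.

Lemma even_cycles_of_avg_degree (T : finType) (e : rel T) :
  simple_graph e -> ~~ has_cycle e l -> 96%:R * dk R k l <= avg_degree R e ->
  exists m : nat, forall i : nat, (1 <= i <= k)%N -> has_cycle e (2 * m + 2 * i)%N.
Proof.
move=> se nc; rewrite avg_degreeE; have D0 := dk_gt0; have D37 := dk_lower R l3 k4.
have [T0|T0] := posnP #|T|; first by rewrite T0 invr0 mulr0; lra.
have T0' : 0 < #|T|%:R :> R by rewrite ltr0n.
rewrite ler_pdivlMr // => Edense.
have [ei es] := simple_graphP _ se.
have [A HA] := half_cut ei.
set e' := [rel x y | _] in HA.
have se' : simple_graph e'.
  apply/simple_graphP; split=> [x|x y]; first by rewrite /e' /= ei.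
  by rewrite /e' /= es eq_sym.
have be' : bipartite e' by apply/bipartiteP; exists A => x y /andP[].
have e'e x y : e' x y -> e x y by case/andP.
have hom n : has_cycle e' n -> has_cycle e n.
  by apply: (@has_cycle_hom _ _ _ e' e id (fun=> tt)).
have nc' : ~~ has_cycle e' l by apply: contra nc; apply: hom.
(* Writing [D] for [dk R k l]: sparsity needs [7 * D < d], and the halved degree bound [48 * D] must
   exceed [4 * d <= 32 * D + 4], which holds since [D >= 3/7]. *)
pose d := (Num.truncn (8%:R * dk R k l)).+1.
have /andP[d1 d2] : (d%:R <= 8%:R * dk R k l + 1) && (8%:R * dk R k l < d%:R).
  have /Num.Theory.truncn_itv/andP[h1 h2] : 0 <= 8%:R * dk R k l by lra.
  by rewrite h2 andbT /d -addn1 natrD lerD2r.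
have [||Y /andP[Y0 Yk]||m Hm] := @consecutive_even_cycles T e' d k se' be'.
- by rewrite -(ltr_nat R); lra.
- by lia.
- have := dk_sparse R l3 (Y := Y) k4 se' be' nc' (introT andP (conj Y0 Yk)).
  rewrite -(ltr_nat R) natrM [(d * _)%:R]natrM => H; apply: le_lt_trans H _.
  by rewrite ltr_pM2r ?ltr0n //; lra.
- rewrite -(ltr_nat R) natrM; move: HA; rewrite -(ler_nat R) natrM => HA.
  have : (4 * d)%:R * #|T|%:R < 48%:R * dk R k l * #|T|%:R.
    by rewrite ltr_pM2r // natrM; lra.
  lra.
by exists m => i /Hm/hom.
Qed.

(** With [k * z + l = 2 * w], any [i] congruent to [w - m] works, and one lies between 1 and [k]. *)
Lemma even_cycle_mod (m : nat) : (exists z : int, (2 %| k%:Z * z + l%:Z)%Z) ->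
  exists2 i, (1 <= i <= k)%N & (2 * m + 2 * i = l %[mod k])%N.
Proof.
move=> [z /dvdzP[w wE]].
have k0 : 0 < k%:Z by lia.
have k0' : k%:Z != 0 by lia.
have h1 := modz_ge0 (w - m%:Z - 1) k0'.
have h2 := ltz_pmod (w - m%:Z - 1) k0.
have h3 := divz_eq (w - m%:Z - 1) k%:Z.
set q := ((w - m%:Z - 1) %/ k%:Z)%Z in h3.
exists (`|((w - m%:Z - 1) %% k%:Z)%Z| + 1)%N; first by lia.
apply/eqP; rewrite -eqz_nat -!modz_nat eqz_mod_dvd; apply/dvdzP; exists (z - 2 * q).
lia.
Qed.

(** On at most [k] vertices, a cycle of length congruent to [l] modulo [k] has length exactly
    [l]. *)
Lemma dk_le_forces (c : R) : forces_cycle_mod k l c -> dk R k l <= c.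
Proof.
move=> Hc.
have Hlt (T : finType) (e : rel T) : simple_graph e -> (#|T| <= k)%N ->
    ~~ has_cycle e l -> avg_degree R e < c.
  move=> se Tk nc; rewrite ltNge; apply/negP => /(Hc _ _ se)[n hn nl].
  have /andP[n3 nT] := has_cycle_size hn.
  have nk := leq_trans nT Tk.
  have nlE : n = l.
    rewrite (modn_small lk) in nl; move: nk; rewrite leq_eqVlt => /orP[/eqP nk|nk].
      by move: nl; rewrite nk modnn; lia.
    by rewrite modn_small in nl.
  by rewrite nlE (negbTE nc) in hn.
apply: bigmax_le => [|E /and3P[sE bE nE]]; last by apply/ltW/Hlt; rewrite ?card_ord.
(* The empty graph, of average degree 0, handles the neutral value of the maximum. *)
have := Hlt void [rel x y | false]; rewrite /avg_degree card_void invr0 mulr0.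
move=> H; apply/ltW/H => //; first by apply/simple_graphP.
by apply/negP => /has_cycle_size; rewrite card_void; lia.
Qed.

Lemma is_ck_inf (c : R) : forces_cycle_mod k l c ->
  is_ck k l (inf (forces_cycle_mod k l : set R)).
Proof.
move=> Hc; set S := forces_cycle_mod k l.
have Slb : lbound S (dk R k l) by move=> x /dk_le_forces.
have hS : has_inf S by split; [exists c | exists (dk R k l)].
split; last by move=> x; apply: ge_inf; case: hS.
move=> T e se cavg.
have Dinf : dk R k l <= inf S by apply: lb_le_inf => //; exists c.
have T0 : (0 < #|T|)%N.
  rewrite lt0n; apply/negP => /eqP T0; move: cavg.
  by rewrite avg_degreeE T0 invr0 mulr0 => H; have := dk_gt0; lra.
have [v0 _] := card_gt0P T0.
have T0' : 0 < #|T|%:R :> R by rewrite ltr0n.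
(* The gain [1 / #|T|] lifts a graph of average degree at least the infimum above some member of the
   set. *)
have avgE : avg_degree R (bridge e v0) = avg_degree R e + #|T|%:R^-1.
  rewrite !avg_degreeE bridge_nedges card_prod card_bool natrD !natrM.
  by field; rewrite ?gt_eqF.
have invT0 : 0 < #|T|%:R^-1 :> R by rewrite invr_gt0.
have [c' Sc' c'lt] := inf_adherent invT0 hS.
have [|n hn nl] := Sc' _ _ (bridge_simple v0 se); first by rewrite avgE; lra.
by exists n => //; apply: bridge_cycle hn.
Qed.

End Main.

Theorem theorem1 (R : realType) (k l : nat) (hl : (3 <= l)%N) (hlk : (l < k)%N) :
  (forall (T : finType) (e : rel T),
     simple_graph e -> ~~ has_cycle e l ->
     96%:R * dk R k l <= avg_degree R e ->
     exists m : nat, forall i : nat, (1 <= i <= k)%N ->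
       has_cycle e (2 * m + 2 * i)%N)
  /\
  ((exists z : int, (2 %| k%:Z * z + l%:Z)%Z) ->
     (exists c : R, is_ck k l c) /\
     (forall c : R, is_ck k l c -> dk R k l <= c <= 96%:R * dk R k l)).
Proof.
split; first exact: even_cycles_of_avg_degree.
move=> even_kl.
have forces96 : forces_cycle_mod k l (96%:R * dk R k l).
  move=> T e se avg; have [hc|nc] := boolP (has_cycle e l); first by exists l.
  have [m Hm] := even_cycles_of_avg_degree hl hlk se nc avg.
  have [i ik mi] := even_cycle_mod hl hlk m even_kl.
  by exists (2 * m + 2 * i)%N => //; apply: Hm.
split; first by exists (inf (forces_cycle_mod k l)); apply: is_ck_inf forces96.
move=> c [cS clb]; rewrite dk_le_forces //=.
exact: clb.
Qed.
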